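(* Let $K$ be a field. Let $T$ be a finite forest and let $v$ be a vertex of $T$ whose neighbours are $v_1,\dots,v_n$, where $n\geq 2$ and $v_1,\dots,v_{n-1}$ have degree one in $T$. Let $T'$ be the subgraph of $T$ obtained by deleting the vertex $v_1$, and let $T''$ be the subgraph of $T$ obtained by deleting the vertices $v,v_1,\dots,v_n$. Then \[ \mathrm{pd}(T)=\max\{\mathrm{pd}(T'),\ \mathrm{pd}(T'')+n\}. \]
   Context: All graphs are finite and simple; a forest is a graph with no cycles. The degree of a vertex is its number of neighbours. Deleting a set of vertices from a graph means also deleting all edges incident to them. For a graph $G$ with vertex set $V(G)$ and edge set $E(G)$, let $K[V(G)]$ be the polynomial ring over the field $K$ whose variables are the vertices of $G$, and let $I(G)$ be the ideal generated by the monomials $uv$ with $\{u,v\}\in E(G)$. The numbers $\beta_{i,d}(G)$ are the graded Betti numbers of $K[V(G)]/I(G)$ over $K[V(G)]$ (standard grading): the $i$th module of the graded minimal free resolution is $\bigoplus_d K[V(G)](-d)^{\beta_{i,d}(G)}$. Thus $\beta_{0,d}(G)=\delta_{d,0}$, and $\beta_{i,d}(G)=0$ for $i<0$ by convention. The total Betti numbers are $\beta_i(G)=\sum_d\beta_{i,d}(G)$, and $\mathrm{pd}(G)=\max\{i\in\mathbb{Z} : \beta_i(G)>0\}$ is the projective dimension of $K[V(G)]/I(G)$ over $K[V(G)]$. The graph with no vertices is allowed; its ring is $K$, so its projective dimension is $0$. *)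

(* Defs.v *)
From mathcomp Require Import all_boot all_order all_algebra.
From mathcomp Require Export mpoly.
From Stdlib Require Import ClassicalEpsilon.

Set Implicit Arguments.
Unset Strict Implicit.
Unset Printing Implicit Defensive.

Import GRing.Theory.
Local Open Scope ring_scope.

(** * Finite simple graphs *)

Record sgraph := SGraph {
  vertex :> finType;
  edge : rel vertex;
  edge_sym : ssrbool.symmetric edge;
  edge_irrefl : irreflexive edge }.

Section Graphs.
Variable G : sgraph.

Definition neighbours (x : G) : {set G} := [set y | edge x y].

Definition degree (x : G) : nat := #|neighbours x|.

(* For a symmetric irreflexive relation, a duplicate-free closed walk with at
   least three vertices is a cycle of the graph; those with two vertices merely
   traverse an edge back and forth. *)
Definition is_forest : Prop :=
  forall c : seq G, ucycle (@edge G) c -> (size c <= 2)%N.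

Definition del_edge (D : {set G}) : rel {x : G | x \notin D} :=
  fun x y => edge (val x) (val y).

Lemma del_edge_sym (D : {set G}) : ssrbool.symmetric (@del_edge D).
Proof. by move=> x y; apply: edge_sym. Qed.

Lemma del_edge_irrefl (D : {set G}) : irreflexive (@del_edge D).
Proof. by move=> x; apply: edge_irrefl. Qed.

Definition delete_vertices (D : {set G}) : sgraph :=
  SGraph (@del_edge_sym D) (@del_edge_irrefl D).

End Graphs.

(** * Edge ideals *)

(* K[V(G)]: the variable attached to a vertex is indexed by its [enum_rank]. *)
Notation vpoly K G := {mpoly K[#|vertex G|]}.

Definition vvar (K : fieldType) (G : sgraph) (x : G) : vpoly K G :=
  'X_(enum_rank x).

Definition edge_ideal (K : fieldType) (G : sgraph) (f : vpoly K G) : Prop :=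
  exists c : G -> G -> vpoly K G,
    f = \sum_(x : G) \sum_(y : G | edge x y) c x y * (vvar K x * vvar K y).

(** * Minimal graded free resolutions *)

(* Homogeneous of degree [d], for an integer [d]; only 0 has negative degree. *)
Definition homogz (K : fieldType) (n : nat) (d : int) (p : {mpoly K[n]}) : bool :=
  match d with
  | Posz m => p \is m.-homog
  | Negz _ => p == 0
  end.

(* A sequence ... -> F_2 -> F_1 -> F_0 -> S / I with S = K[x_1, ..., x_n] and
   F_i = \bigoplus_(j < rk i) S(- shift i j).  Elements of F_i are row vectors,
   the map F_(i+1) -> F_i is [u |-> u *m diff i], and [aug] is a lift to S of
   the augmentation F_0 -> S / I. *)
Record free_complex (K : fieldType) (n : nat) := FreeComplex {
  rk : nat -> nat;
  shift : forall i, 'I_(rk i) -> int;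
  aug : 'cV[{mpoly K[n]}]_(rk 0);
  diff : forall i, 'M[{mpoly K[n]}]_(rk i.+1, rk i) }.

Definition zero_complex (K : fieldType) (n : nat) : free_complex K n :=
  @FreeComplex K n (fun=> 0%N) (fun _ _ => 0) 0 (fun=> 0).

Section Resolution.
Variables (K : fieldType) (n : nat).
Variables (I : {mpoly K[n]} -> Prop) (F : free_complex K n).

(* All maps are homogeneous of degree 0.  The j-th basis vector of
   F_(i+1) lives in degree [shift i.+1 j], hence the degree of the entries. *)
Definition graded_maps : Prop :=
  (forall j, homogz (shift j) (aug F j 0)) /\
  (forall i j k, homogz (shift j - shift k) (diff F i j k)).

Definition exact_augmented : Prop :=
  [/\ forall f : {mpoly K[n]}, exists u : 'rV_(rk F 0),
        I (f - (u *m aug F) 0 0),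
      forall u : 'rV_(rk F 0), I ((u *m aug F) 0 0) <->
        exists w : 'rV_(rk F 1), u = w *m diff F 0
    & forall i (u : 'rV_(rk F i.+1)), u *m diff F i = 0 <->
        exists w : 'rV_(rk F i.+2), u = w *m diff F i.+1].

(* The image of F_(i+1) lies in (x_1, ..., x_n) F_i. *)
Definition minimal_maps : Prop :=
  forall i j k, (diff F i j k)@_0%MM = 0.

Definition is_min_graded_free_res : Prop :=
  [/\ graded_maps, exact_augmented & minimal_maps].

End Resolution.

(** * Betti numbers and projective dimension of K[V(G)] / I(G) *)

Section Betti.
Variables (K : fieldType) (G : sgraph).

(* The minimal graded free resolution exists and is unique up to isomorphism,
   so the numbers below do not depend on the one that is chosen. *)
Definition min_res : free_complex K #|vertex G| :=
  epsilon (inhabits (zero_complex K #|vertex G|))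
          (is_min_graded_free_res (@edge_ideal K G)).

Definition graded_betti (i : nat) (d : int) : nat :=
  #|[set j : 'I_(rk min_res i) | shift j == d]|.

(* The sum over all [d]; only the shifts of F_i contribute. *)
Definition betti (i : nat) : nat :=
  (\sum_(d <- undup (codom (@shift _ _ min_res i))) graded_betti i d)%N.

(* The largest index of a nonzero Betti number.  Negative indices are left out:
   their Betti numbers vanish by convention, and [betti 0] is 1. *)
Definition proj_dim : nat :=
  epsilon (inhabits 0%N)
          (fun p => (0 < betti p)%N /\ forall i, (0 < betti i)%N -> (i <= p)%N).

End Betti.

(* Main.v *)
Require Import Defs.
From HB Require Import structures.
From mathcomp Require Import all_boot all_order all_algebra.
From mathcomp Require Import zify ring.
From Stdlib Require Import ClassicalEpsilon.

(** Write [S] for the polynomial ring, [v1] for the leaf and [v] for its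
    neighbour.  Since [v] is the only neighbour of [v1],
    [I(T) = I(T') + (v1 v)], and multiplication by [v1 v] gives the short
    exact sequence [0 -> S / (I(T') : v1 v) -> S / I(T') -> S / I(T) -> 0].
    The variable [v1] does not occur in [I(T')], so
    [I(T') : v1 v = I(T') : v], and this colon ideal is the sum of [I(T'')] and
    the ideal of the neighbours of [v] other than [v1]: dividing an edge of [T']
    at [v] by [v] leaves such a neighbour, and the neighbours absorb the edges
    that meet them.

    A resolution of [S / I(T)] is therefore the mapping cone of a chain map
    from a resolution [F] of [S / (I(T') : v)] to a resolution [G] of
    [S / I(T')] lifting multiplication by [v1 v].  Choosing this chain map to be
    [v1] times a lift of multiplication by [v] puts its entries in the maximal
    ideal, so the cone of minimal resolutions is minimal, and its length is
    [max (length G) (length F + 1)] ([has_min_res_cone]).  The same cone with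
    [v] replaced by 1 adds one variable that is regular modulo the ideal and
    lengthens the resolution by one; starting from [I(T'')] and adding the
    [n - 1] other neighbours gives [length F = pd(T'') + n - 1].

    Two facts connect these resolutions with the projective dimensions of the
    statement.  The ranks in a minimal resolution depend only on the ideal
    ([min_res_rk]): comparison maps between two minimal resolutions are inverse
    to each other up to homotopy, hence inverse modulo the maximal ideal.  And
    the rings of [T'] and [T''] are smaller than [S]; as [S] is free over them,
    extending scalars preserves minimal resolutions
    ([has_min_res_base_change]).  A forest with an edge has a leaf
    ([forest_leaf]), so the cone construction also yields, by induction on the
    number of vertices, the finite minimal resolution on which the definition
    of the projective dimension relies ([forest_has_min_res]).

    All the ideals involved are monomial, and are handled through the predicate
    on exponent vectors that says which monomials they contain ([mideal]). *)

Set Implicit Arguments.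
Unset Strict Implicit.
Unset Printing Implicit Defensive.

Import GRing.Theory.
Local Open Scope ring_scope.

(** * Homogeneous components, homogeneous ideals and graded lifting *)

(** Chain maps and homotopies are built degree by degree: [Q] records the
    invariant that makes the next step possible, [R] the relation between two
    successive terms. *)
Lemma dependent_choice (A : nat -> Type) (Q : forall i, A i -> Prop)
    (R : forall i, A i -> A i.+1 -> Prop) :
  (exists a, Q 0%N a) ->
  (forall i a, Q i a -> exists b, Q i.+1 b /\ R i a b) ->
  exists f : forall i, A i, forall i, Q i (f i) /\ R i (f i) (f i.+1).
Proof.
move=> h0 hS.
have h0' : {a | Q 0%N a} by exact: constructive_indefinite_description.
have next i (a : {a | Q i a}) : {b : {b | Q i.+1 b} | R i (sval a) (sval b)}.
  apply: constructive_indefinite_description.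
  by have [b [Qb Rb]] := hS i _ (svalP a); exists (exist _ b Qb).
pose F := fix F i : {a | Q i a} :=
  match i with 0%N => h0' | i'.+1 => sval (next i' (F i')) end.
exists (fun i => sval (F i)) => i; split; first exact: svalP.
exact: (svalP (next i (F i))).
Qed.

Section Homogeneous.
Variables (K : fieldType) (n : nat).
Local Notation S := {mpoly K[n]}.
Implicit Types (p q : S) (m : 'X_{1..n}) (d e : int).

Lemma homogzP d p :
  reflect (forall m, p@_m != 0 -> (mdeg m)%:Z = d) (homogz d p).
Proof.
case: d => d /=.
  apply: (iffP (dhomogP _ _ _)) => [h m | h m].
    by rewrite -mcoeff_msupp => /h ->.
  by rewrite mcoeff_msupp => /h [].
apply: (iffP eqP) => [-> m | h]; first by rewrite mcoeff0 eqxx.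
by apply/mpolyP => m; rewrite mcoeff0; apply/eqP/negPn/negP => /h.
Qed.

Lemma homogz0 d : homogz d (0 : S).
Proof. by apply/homogzP => m; rewrite mcoeff0 eqxx. Qed.

Lemma homogzN d p : homogz d p -> homogz d (- p).
Proof. by move/homogzP=> h; apply/homogzP => m; rewrite mcoeffN oppr_eq0 => /h. Qed.

Lemma homogzD d p q : homogz d p -> homogz d q -> homogz d (p + q).
Proof.
move=> /homogzP hp /homogzP hq; apply/homogzP => m; rewrite mcoeffD => h.
have [p0|/hp //] := eqVneq p@_m 0.
by apply: hq; apply: contraNneq h => ->; rewrite p0 addr0.
Qed.

Lemma homogz_sum (I : Type) (r : seq I) (P : pred I) (F : I -> S) d :
  (forall i, P i -> homogz d (F i)) -> homogz d (\sum_(i <- r | P i) F i).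
Proof.
by move=> h; apply: (big_ind (fun p => homogz d p));
  [exact: homogz0 | exact: homogzD | exact: h].
Qed.

Lemma homogzM d e p q : homogz d p -> homogz e q -> homogz (d + e) (p * q).
Proof.
move=> /homogzP hp /homogzP hq; apply/homogzP => m.
rewrite -mcoeff_msupp => /msuppM_le/allpairsP[[m1 m2] /= [h1 h2 ->]].
by rewrite -(hp m1) -?mcoeff_msupp // -(hq m2) -?mcoeff_msupp // mdegD.
Qed.

Lemma homogzX m : homogz (mdeg m) ('X_[m] : S).
Proof.
by apply/homogzP => m'; rewrite mcoeffX; case: (m =P m') => [->|]; rewrite ?eqxx.
Qed.

(** The homogeneous component of degree [d]; it is zero for negative [d], so that
    degrees can be subtracted freely. *)
Definition hcomp d p : S :=
  if d is Posz d' then pihomog mdeg d' p else 0.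

Lemma hcomp_is_linear d : linear (hcomp d).
Proof. by case: d => d a p q; rewrite /hcomp ?linearP // scaler0 addr0. Qed.

HB.instance Definition _ d :=
  GRing.isLinear.Build K S S _ (hcomp d) (hcomp_is_linear d).

Lemma hcompX d m :
  hcomp d 'X_[m] = if (mdeg m)%:Z == d then 'X_[m] else 0.
Proof. by case: d => d //=; rewrite pihomogX. Qed.

Lemma mcoeff_hcomp d p m :
  (hcomp d p)@_m = if (mdeg m)%:Z == d then p@_m else 0.
Proof.
have hX k : (hcomp d 'X_[k])@_m = if (mdeg m)%:Z == d then 'X_[k]@_m else 0.
  rewrite hcompX mcoeffX; case: (k =P m) => [->|hk].
    by case: ifP => _; rewrite ?mcoeff0 // mcoeffX eqxx.
  by rewrite if_same; case: ifP => _; rewrite ?mcoeff0 // mcoeffX; case: eqP.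
rewrite [p]mpolyE !linear_sum /=.
case: ifP hX => hm hX; [apply: eq_bigr | rewrite big1 //] => k _;
  by rewrite !linearZ /= hX ?mulr0.
Qed.

Lemma hcomp_homog d p : homogz d (hcomp d p).
Proof.
by apply/homogzP => m; rewrite mcoeff_hcomp; case: (_ =P d); rewrite ?eqxx.
Qed.

Lemma hcomp_id d p : homogz d p -> hcomp d p = p.
Proof.
move/homogzP=> hp; apply/mpolyP => m; rewrite mcoeff_hcomp; case: (_ =P d) => // h.
by apply/esym/eqP/negPn/negP => /hp.
Qed.

Lemma hcompMr d e p q : homogz e q -> hcomp d (p * q) = hcomp (d - e) p * q.
Proof.
move=> hq; rewrite [p]mpolyE mulr_suml !linear_sum /= mulr_suml.
apply: eq_bigr => m _; rewrite -!scalerAl !linearZ /= -scalerAl; congr (_ *: _).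
have hmq := homogzM (homogzX m) hq.
rewrite hcompX; case: eqP => h.
  by rewrite hcomp_id //; move: hmq; rewrite h subrK.
rewrite mul0r; apply/mpolyP => k; rewrite mcoeff_hcomp mcoeff0.
case: (_ =P d) => // hk.
apply/eqP/negPn/negP => /(homogzP _ _ hmq) h'.
by apply: h; rewrite -hk h' addrK.
Qed.

Record homog_ideal (I : S -> Prop) : Prop := HomogIdeal {
  hideal0 : I 0;
  hidealD : forall p q, I p -> I q -> I (p + q);
  hidealM : forall a p, I p -> I (a * p);
  hideal_hcomp : forall d p, I p -> I (hcomp d p) }.

Section IdealTheory.
Variables (I : S -> Prop) (hI : homog_ideal I).

Lemma hidealN p : I p -> I (- p).
Proof. by rewrite -mulN1r; apply: hidealM. Qed.

Lemma hidealB p q : I p -> I q -> I (p - q).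
Proof. by move=> hp hq; apply: (hidealD hI) => //; apply: hidealN. Qed.

Lemma hideal_sum (J : Type) (r : seq J) (P : pred J) (F : J -> S) :
  (forall i, P i -> I (F i)) -> I (\sum_(i <- r | P i) F i).
Proof.
by move=> h; apply: (big_ind I); [exact: hideal0 | exact: hidealD | exact: h].
Qed.

Lemma hideal_mulmx a b (M : 'M[S]_(a, b)) (x y : 'cV[S]_b) i :
  (forall j, I (x j 0 - y j 0)) -> I ((M *m x) i 0 - (M *m y) i 0).
Proof.
move=> h; rewrite !mxE -sumrB; apply: hideal_sum => j _.
by rewrite -mulrBr; apply: (hidealM hI).
Qed.

End IdealTheory.

Definition homog_mx a b (s : 'I_a -> int) (t : 'I_b -> int) (M : 'M[S]_(a, b)) :=
  forall j k, homogz (s j - t k) (M j k).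

Lemma homog_mxM a b c (s : 'I_a -> int) (t : 'I_b -> int) (r : 'I_c -> int)
    (M : 'M[S]_(a, b)) (N : 'M[S]_(b, c)) :
  homog_mx s t M -> homog_mx t r N -> homog_mx s r (M *m N).
Proof.
move=> hM hN j k; rewrite mxE; apply: homogz_sum => i _.
by rewrite -(subrKA (t i)); apply: homogzM.
Qed.

(** A homogeneous matrix whose rows lie in the image of a homogeneous [B] has a
    homogeneous lift: replacing every coefficient of an arbitrary lift by its
    component of the expected degree does not change the product with [B]. *)
Lemma homog_lift a b c (s : 'I_a -> int) (t : 'I_b -> int) (r : 'I_c -> int)
    (M : 'M[S]_(a, c)) (B : 'M[S]_(b, c)) :
  homog_mx s r M -> homog_mx t r B ->
  (forall j, exists w : 'rV_b, row j M = w *m B) ->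
  exists2 W : 'M_(a, b), homog_mx s t W & M = W *m B.
Proof.
move=> hM hB /fin_all_exists[w hw].
exists (\matrix_(j, k) hcomp (s j - t k) (w j 0 k)).
  by move=> j k; rewrite mxE hcomp_homog.
apply/matrixP => j l; rewrite -(hcomp_id (hM j l)).
have -> : M j l = (w j *m B) 0 l by rewrite -hw mxE.
rewrite !mxE linear_sum /=; apply: eq_bigr => k _.
rewrite mxE (hcompMr _ _ (hB k l)); congr (hcomp _ _ * _).
by rewrite opprB addrA subrK.
Qed.

(** The bottom step of a lift, where the augmentation is exact modulo [I] only. *)
Lemma homog_lift_mod (I : S -> Prop) (hI : homog_ideal I) a b
    (s : 'I_a -> int) (t : 'I_b -> int) (x : 'cV[S]_a) (y : 'cV[S]_b) :
  (forall j, homogz (s j) (x j 0)) -> (forall j, homogz (t j) (y j 0)) ->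
  (forall j, exists w : 'rV_b, I (x j 0 - (w *m y) 0 0)) ->
  exists2 W : 'M_(a, b), homog_mx s t W & forall j, I ((W *m y) j 0 - x j 0).
Proof.
move=> hx hy /fin_all_exists[w hw].
exists (\matrix_(j, k) hcomp (s j - t k) (w j 0 k)).
  by move=> j k; rewrite mxE hcomp_homog.
move=> j; rewrite -opprB; apply: (hidealN hI).
have := hideal_hcomp hI (s j) (hw j); rewrite linearB /= hcomp_id //.
rewrite !mxE linear_sum /=; congr (I (_ - _)); apply: eq_bigr => k _.
by rewrite mxE (hcompMr _ _ (hy k)).
Qed.

End Homogeneous.

(** * Uniqueness of minimal resolutions *)

Section Comparison.
Variables (K : fieldType) (n : nat).
Local Notation S := {mpoly K[n]}.
Implicit Types (I J L : S -> Prop) (F G : free_complex K n).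

Lemma res_diff0 I F j : homog_ideal I -> exact_augmented I F ->
  I ((diff F 0 *m aug F) j 0).
Proof.
move=> hI [_ h _]; have := (h (row j (diff F 0))).2.
rewrite -row_mul mxE; apply.
by exists (delta_mx 0 j); rewrite rowE.
Qed.

Lemma res_diffK I F i : exact_augmented I F -> diff F i.+1 *m diff F i = 0.
Proof.
move=> [_ _ h]; apply/row_matrixP => j; rewrite row_mul row0; apply/h.
by exists (delta_mx 0 j); rewrite rowE.
Qed.

(** The comparison theorem for multiplication by [g], with [F] over [S / L] and
    [G] over [S / J]: freeness of the modules of [F] lets each row be lifted
    separately along [diff G], and exactness of [G] applies because the row to be lifted is
    a cycle. *)
Lemma comparison_map J L F G (g : S) (e : int) :
  homog_ideal J -> homog_ideal L ->
  graded_maps F -> graded_maps G ->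
  exact_augmented L F -> exact_augmented J G ->
  homogz e g -> (forall h, L h -> J (h * g)) ->
  exists phi : forall i, 'M[S]_(rk F i, rk G i),
    [/\ forall j, J ((phi 0%N *m aug G) j 0 - aug F j 0 * g),
        forall i, phi i.+1 *m diff G i = diff F i *m phi i
      & forall i, homog_mx (fun j => shift j + e) (@shift _ _ G i) (phi i)].
Proof.
move=> hJ hL [augF diffF] [augG diffG] exF exG hg LJ.
have [exG0 exG1 exG2] := exG.
pose hom i (phi : 'M[S]_(rk F i, rk G i)) :=
  homog_mx (fun j => shift j + e) (@shift _ _ G i) phi.
(* In positive degrees it is enough to remember that phi lifts some matrix
   along the differentials: this makes diff F *m phi a matrix of cycles. *)
pose Q i : 'M[S]_(rk F i, rk G i) -> Prop :=
  match i with
  | 0%N => fun phi => hom 0%N phi /\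
      forall j, J ((phi *m aug G) j 0 - aug F j 0 * g)
  | i'.+1 => fun phi => hom i'.+1 phi /\
      exists psi, phi *m diff G i' = diff F i' *m psi
  end.
have Qhom i phi : Q i phi -> hom i phi by case: i phi => [|i] phi [].
have [||phi hphi] := @dependent_choice _ Q
   (fun i phi psi => psi *m diff G i = diff F i *m phi).
- have [||j|W hW1 hW2] := @homog_lift_mod _ _ _ hJ _ _
    (fun j => shift j + e) (@shift _ _ G 0) (\col_j (aug F j 0 * g)) (aug G).
  + by move=> j; rewrite mxE; apply: homogzM.
  + exact: augG.
  + by rewrite mxE; apply: exG0.
  + by exists W; split => // j; move: (hW2 j); rewrite !mxE.
- move=> i phi Qphi.
  have [||j|W hW1 hW2] := @homog_lift _ _ _ _ _
      (fun j => shift j + e) (@shift _ _ G i.+1) (@shift _ _ G i)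
      (diff F i *m phi) (diff G i).
  + apply: (homog_mxM (t := fun j => shift j + e)) (Qhom _ _ Qphi) => j k.
    by rewrite opprD addrACA subrr addr0; apply: diffF.
  + exact: diffG.
  + case: i j phi Qphi => [|i] j phi [hphi Qphi].
      apply/exG1; rewrite -row_mul mxE -mulmxA.
      have Jg : J ((diff F 0 *m (\col_j (aug F j 0 * g))) j 0).
        have -> : \col_j (aug F j 0 * g) = g *: aug F.
          by apply/matrixP => k l; rewrite !mxE mulrC ord1.
        rewrite -scalemxAr mxE mulrC; apply: LJ.
        exact: res_diff0.
      rewrite -[X in J X](subrK ((diff F 0 *m (\col_j (aug F j 0 * g))) j 0)).
      apply: (hidealD hJ) => //.
      apply: (hideal_mulmx hJ) => k; rewrite [(\col__ _) k 0]mxE; exact: Qphi.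
    apply/exG2; have [psi hpsi] := Qphi.
    by rewrite -row_mul -mulmxA hpsi mulmxA (res_diffK _ exF) mul0mx row0.
  + by exists W; split => //; split => //; exists phi.
exists phi; split.
- by case: (hphi 0%N) => [[]].
- by move=> i; case: (hphi i).
- by move=> i; case: (hphi i) => /Qhom.
Qed.

(** A self-map of a minimal resolution over the zero map is null-homotopic; as
    the differentials vanish modulo the maximal ideal, so does the self-map. *)
Lemma null_homotopic_minimal I F (h : forall i, 'M[S]_(rk F i)) :
  homog_ideal I -> exact_augmented I F -> minimal_maps F ->
  (forall j, I ((h 0%N *m aug F) j 0)) ->
  (forall i, h i.+1 *m diff F i = diff F i *m h i) ->
  forall i, map_mx (mcoeff 0%MM) (h i) = 0.
Proof.
move=> hI exF minF h0 hS; have [_ ex1 ex2] := exF.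
have min0 i : map_mx (mcoeff 0%MM) (diff F i) = 0.
  by apply/matrixP => j k; rewrite !mxE minF.
pose Q i : 'M[S]_(rk F i, rk F i.+1) -> Prop :=
  match i with
  | 0%N => fun s => h 0%N = s *m diff F 0%N
  | i'.+1 => fun s => exists t, h i'.+1 = diff F i' *m t + s *m diff F i'.+1
  end.
have Qdiff i s : Q i s -> diff F i *m (h i - s *m diff F i) = 0.
  case: i s => [|i] s /=; first by move=> ->; rewrite subrr mulmx0.
  case=> t ->; rewrite addrK mulmxA (res_diffK _ exF); exact: mul0mx.
have [||s hs] := @dependent_choice _ Q
   (fun i s t => h i.+1 = diff F i *m s + t *m diff F i.+1).
- suff /fin_all_exists[w hw] : forall j, exists w : 'rV_(rk F 1),
      row j (h 0%N) = w *m diff F 0.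
    exists (\matrix_j w j); apply/row_matrixP => j.
    by rewrite row_mul rowK hw.
  by move=> j; apply/ex1; rewrite -row_mul mxE; apply: h0.
- move=> i s Qs.
  suff /fin_all_exists[w hw] : forall j, exists w : 'rV_(rk F i.+2),
      row j (h i.+1 - diff F i *m s) = w *m diff F i.+1.
    exists (\matrix_j w j).
    have E : h i.+1 = diff F i *m s + (\matrix_j w j) *m diff F i.+1.
      apply/eqP; rewrite addrC -subr_eq; apply/eqP.
      by apply/row_matrixP => j; rewrite row_mul rowK -hw.
    by split=> //; exists s.
  move=> j; apply/ex2; rewrite -row_mul mulmxBl hS -mulmxA -mulmxBr.
  by rewrite Qdiff // row0.
move=> i; case: i (hs i).1 => [->|i [t ->]].
  by rewrite map_mxM min0 mulmx0.
by rewrite map_mxD !map_mxM !min0 mulmx0 mul0mx addr0.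
Qed.

(** With comparison maps [f : F -> G] and [g : G -> F], the difference
    [f *m g - 1] lies over zero.  Hence the constant terms of [f] and [g] satisfy
    [f *m g = 1] over the field [K], which bounds the ranks. *)
Lemma min_res_rk_le I F G i : homog_ideal I ->
  is_min_graded_free_res I F -> is_min_graded_free_res I G ->
  (rk F i <= rk G i)%N.
Proof.
move=> hI [gF exF minF] [gG exG minG].
have h1 : homogz 0 (1 : S).
  by rewrite -mpolyX0; have := @homogzX K n 0%MM; rewrite mdeg0.
have h1I h : I h -> I (h * 1) by rewrite mulr1.
have [f [f0 fS _]] := comparison_map hI hI gF gG exF exG h1 h1I.
have [g [g0 gS _]] := comparison_map hI hI gG gF exG exF h1 h1I.
pose h i := f i *m g i - 1%:M.
have hh := @null_homotopic_minimal I F h hI exF minF.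
have {}hh : map_mx (mcoeff 0%MM) (h i) = 0.
  apply: hh => [j|k].
    rewrite mulmxBl mul1mx -mulmxA !mxE.
    have := hideal_mulmx hI (f 0%N) j
      (x := g 0%N *m aug F) (y := aug G).
    move=> /(_ _)/(hidealD hI) H; move: (f0 j); rewrite mulr1 => /H.
    rewrite !mxE addrA subrK; apply=> k.
    by move: (g0 k); rewrite mulr1.
  by rewrite mulmxBl mulmxBr mul1mx mulmx1 -mulmxA gS !mulmxA fS.
move/eqP: hh; rewrite map_mxB map_mxM map_mx1 subr_eq0 => /eqP.
exact: mulmx1_min.
Qed.

Lemma min_res_rk I F G i : homog_ideal I ->
  is_min_graded_free_res I F -> is_min_graded_free_res I G ->
  rk F i = rk G i.
Proof.
by move=> hI hF hG; apply/eqP; rewrite eqn_leq !(min_res_rk_le _ hI).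
Qed.

(** The ideal has a minimal graded free resolution of length exactly [p].  This
    is used instead of [proj_dim] throughout, since it makes sense for every
    ideal and asserts existence as well. *)
Definition has_min_res I (p : nat) : Prop := exists F,
  [/\ is_min_graded_free_res I F, (0 < rk F p)%N
    & forall i, (p < i)%N -> rk F i = 0%N].

End Comparison.

Section ProjDim.
Variables (K : fieldType) (G : sgraph).

Lemma betti_rk i : betti K G i = rk (min_res K G) i.
Proof.
rewrite /betti /graded_betti.
transitivity #|'I_(rk (min_res K G) i)|; last exact: card_ord.
rewrite -[RHS]sum1_card.
under eq_bigr do rewrite cardsE -sum1_card.
rewrite (exchange_big_dep xpredT) //=; apply: eq_bigr => j _.
rewrite sum1_count (eq_count (a2 := pred1 (shift j))) => [|d].
  by rewrite count_uniq_mem ?undup_uniq // mem_undup codom_f.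
by rewrite inE eq_sym.
Qed.

(** Uniqueness of the ranks makes the chosen resolution irrelevant. *)
Lemma proj_dimE p : homog_ideal (@edge_ideal K G) ->
  has_min_res (@edge_ideal K G) p -> proj_dim K G = p.
Proof.
move=> hI [F [hF Fp Fgt]].
have hM : is_min_graded_free_res (@edge_ideal K G) (min_res K G).
  by apply: epsilon_spec; exists F.
have rkM i : betti K G i = rk F i by rewrite betti_rk; apply: min_res_rk hM hF.
have spec : exists q, (0 < betti K G q)%N /\
    forall i, (0 < betti K G i)%N -> (i <= q)%N.
  exists p; rewrite rkM; split=> // i; rewrite rkM.
  by case: (leqP i p) => // /Fgt ->.
have [] := epsilon_spec (inhabits 0%N) _ spec; rewrite -/(proj_dim K G) => pos mx.
apply/eqP; rewrite eqn_leq mx ?rkM // andbT leqNgt.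
by apply/negP => /Fgt h; move: pos; rewrite rkM h.
Qed.

End ProjDim.

(** * Mapping cones *)

(** The cone of [x *: phi], where [phi : F -> G] is a chain map.  The factor [x]
    is kept apart from [phi] because it is what makes the cone minimal; [e] is
    the degree of the map of which [x *: phi] is a lift. *)
Section MappingCone.
Variables (K : fieldType) (n : nat).
Local Notation S := {mpoly K[n]}.
Variables (F G : free_complex K n) (phi : forall i, 'M[S]_(rk F i, rk G i)).
Variables (x : S) (e : int).

Definition cone_rk i : nat :=
  if i is i'.+1 then (rk G i'.+1 + rk F i')%N else rk G 0.

Definition cone_shift i : 'I_(cone_rk i) -> int :=
  match i with
  | 0%N => @shift _ _ G 0
  | i'.+1 => fun j => match split j with
                      | inl a => @shift _ _ G i'.+1 a
                      | inr b => @shift _ _ F i' b + e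
                      end
  end.

Definition cone_diff i : 'M[S]_(cone_rk i.+1, cone_rk i) :=
  match i with
  | 0%N => col_mx (diff G 0) (x *: phi 0)
  | i'.+1 => block_mx (diff G i'.+1) 0 (x *: phi i'.+1) (- diff F i')
  end.

Definition cone : free_complex K n :=
  @FreeComplex K n cone_rk cone_shift (aug G) cone_diff.

Lemma cone_graded (d c : int) : e = d + c -> homogz d x ->
  graded_maps F -> graded_maps G ->
  (forall i, homog_mx (fun j => shift j + c) (@shift _ _ G i) (phi i)) ->
  graded_maps cone.
Proof.
move=> he hx [_ dF] [aG dG] hphi; split; first exact: aG.
have hxphi i j k : homogz (shift j + e - shift k) ((x *: phi i) j k).
  by rewrite he mxE addrCA -addrA; apply: (homogzM hx (hphi i j k)).
case=> [|i] /= j k; rewrite !mxE; case: (split j) => a.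
- exact: dG.
- exact: hxphi.
- rewrite mxE; case: (split k) => b; first exact: dG.
  by rewrite mxE homogz0.
- rewrite mxE; case: (split k) => b; first exact: hxphi.
  by rewrite mxE opprD addrACA subrr addr0; apply/homogzN/dF.
Qed.

Lemma cone_minimal : x@_0%MM = 0 ->
  minimal_maps F -> minimal_maps G -> minimal_maps cone.
Proof.
move=> hx mF mG; case=> [|i] /= j k; rewrite !mxE; case: (split j) => a.
- exact: mG.
- by rewrite mxE rmorphM /= hx mul0r.
- by rewrite mxE; case: (split k) => b; [exact: mG | rewrite mxE mcoeff0].
- rewrite mxE; case: (split k) => b; rewrite mxE.
    by rewrite rmorphM /= hx mul0r.
  by rewrite mcoeffN mF oppr0.
Qed.

Section Exactness.
Variables (J L C : S -> Prop) (g : S).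
Hypothesis hJ : homog_ideal J.
Hypotheses (exF : exact_augmented L F) (exG : exact_augmented J G).
Hypothesis phi0 : forall j, J ((phi 0%N *m aug G) j 0 - aug F j 0 * g).
Hypothesis phiS : forall i, phi i.+1 *m diff G i = diff F i *m phi i.
Hypothesis colonL : forall h, L h <-> J (h * (x * g)).
Hypothesis sumC : forall h, C h <-> exists c, J (h - c * (x * g)).

Lemma cone_aug_mod (b : 'rV_(rk F 0)) :
  J (((x *: (b *m phi 0)) *m aug G) 0 0 - (b *m aug F) 0 0 * (x * g)).
Proof.
rewrite -scalemxAl mxE mulrCA -mulrBr; apply: (hidealM hJ).
have -> : (b *m aug F) 0 0 * g = (b *m (g *: aug F)) 0 0.
  by rewrite -scalemxAr [RHS]mxE mulrC.
rewrite -mulmxA; apply: (hideal_mulmx hJ) => j.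
rewrite [(g *: aug F) j 0]mxE mulrC; exact: phi0.
Qed.

(** This is the long exact sequence of the cone done by hand: the map that
    [x *: phi] lifts, from [S / L] to [S / J], is injective with cokernel
    [S / C]. *)
Lemma cone_exact : exact_augmented C cone.
Proof.
have [exF0 exF1 exF2] := exF; have [exG0 exG1 exG2] := exG.
have entryB (A B : 'M[S]_1) : (A - B) 0 0 = A 0 0 - B 0 0.
  by rewrite !mxE.
have JC h : J h -> C h by move=> Jh; apply/sumC; exists 0; rewrite mul0r subr0.
split.
- by move=> f; have [u /JC Cu] := exG0 f; exists u.
- move=> u; split.
    case/sumC => c hc; have [b hb] := exF0 c.
    have [w hw] : exists w, u - x *: (b *m phi 0) = w *m diff G 0.
      apply/exG1; rewrite mulmxBl entryB.
      have := hidealB hJ hc (cone_aug_mod b).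
      move/colonL: hb => /(hidealD hJ) H /H; congr J; ring.
    exists (row_mx w b); rewrite /= mul_row_col -hw -scalemxAr.
    by rewrite subrK.
  case=> w ->; apply/sumC.
  rewrite -(hsubmxK w); set a := lsubmx _; set b := rsubmx _.
  exists ((b *m aug F) 0 0); rewrite /= mul_row_col mulmxDl.
  rewrite -scalemxAr [X in J (X - _)]mxE.
  rewrite -addrA; apply: (hidealD hJ); last exact: cone_aug_mod.
  by apply/exG1; exists a.
- case=> [|i] /= u; rewrite -(hsubmxK u); set a := lsubmx _; set b := rsubmx _.
    rewrite mul_row_col -scalemxAr; split.
      move=> h0; have [b' hb'] : exists b', b = b' *m diff F 0.
        apply/exF1/colonL; rewrite -[X in J X]opprK.
        apply: (hidealN hJ).
        have := cone_aug_mod b.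
        have -> : x *: (b *m phi 0) = - (a *m diff G 0).
          by apply/eqP; rewrite -addr_eq0 addrC h0.
        rewrite mulNmx [X in J (X - _)]mxE => /(hidealD hJ) H.
        have /H : J ((a *m diff G 0 *m aug G) 0 0) by apply/exG1; exists a.
        by congr J; ring.
      have [a' ha'] : exists a', a + x *: (b' *m phi 1) = a' *m diff G 1.
        apply/exG2; rewrite mulmxDl -scalemxAl -mulmxA phiS mulmxA -hb'.
        exact: h0.
      (* The sign compensates the one of - diff F in the cone. *)
      exists (row_mx a' (- b')); rewrite mul_row_block mulmx0 add0r.
      by rewrite !mulNmx mulmxN opprK -hb' -ha' -scalemxAr addrK.
    case=> w; rewrite -(hsubmxK w); move: (lsubmx w) (rsubmx w) => a' b'.
    rewrite mul_row_block mulmx0 add0r => /eq_row_mx[-> ->].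
    rewrite mulmxDl -mulmxA (res_diffK _ exG) mulmx0 add0r mulmxN.
    by rewrite -scalemxAr -scalemxAl -mulmxA phiS mulNmx mulmxA scalerN subrr.
  rewrite mul_row_block mulmx0 add0r -scalemxAr; split.
    rewrite -[0](@row_mx0 _ _ (rk G i.+1) (rk F i)) => /eq_row_mx[h0].
    rewrite mulmxN => /eqP; rewrite oppr_eq0 => /eqP/exF2[b' hb'].
    have [a' ha'] : exists a', a + x *: (b' *m phi i.+2) = a' *m diff G i.+2.
      apply/exG2; rewrite mulmxDl -scalemxAl -mulmxA phiS mulmxA -hb'.
      exact: h0.
    exists (row_mx a' (- b')); rewrite mul_row_block mulmx0 add0r.
    by rewrite !mulNmx mulmxN opprK -hb' -ha' -scalemxAr addrK.
  case=> w; rewrite -(hsubmxK w); move: (lsubmx w) (rsubmx w) => a' b'.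
  rewrite mul_row_block mulmx0 add0r => /eq_row_mx[-> ->].
  rewrite mulmxDl -mulmxA (res_diffK _ exG) mulmx0 add0r mulmxN.
  rewrite -scalemxAr -scalemxAl -mulmxA phiS mulNmx mulmxA scalerN subrr.
  by rewrite mulmxN mulNmx opprK -mulmxA (res_diffK _ exF) mulmx0 row_mx0.
Qed.

End Exactness.
End MappingCone.

Section HasMinRes.
Variables (K : fieldType) (n : nat).
Local Notation S := {mpoly K[n]}.

(** If [J : g = J : (x g) = L], then [C = J + (x g)] is resolved by the cone of
    [x] times a lift of multiplication by [g].  All entries of this map lie in
    the maximal ideal, so nothing cancels and the lengths can be read off. *)
Lemma has_min_res_cone (J L C : S -> Prop) (x g : S) (d e : int) p q :
  homog_ideal J -> homog_ideal L ->
  homogz d x -> homogz e g -> x@_0%MM = 0 ->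
  (forall h, L h <-> J (h * (x * g))) ->
  (forall h, L h -> J (h * g)) ->
  (forall h, C h <-> exists c, J (h - c * (x * g))) ->
  has_min_res J p -> has_min_res L q -> has_min_res C (maxn p q.+1).
Proof.
move=> hJ hL hx hg x0 colonL Lg sumC.
move=> [G [[gG exG mG] Gp Gge]] [F [[gF exF mF] Fq Fge]].
have [phi [phi0 phiS hphi]] := comparison_map hJ hL gF gG exF exG hg Lg.
have rkS i : rk (cone phi x (d + e)) i.+1 = (rk G i.+1 + rk F i)%N by [].
exists (cone phi x (d + e)); split.
- split; [exact: (cone_graded erefl hx) | | exact: cone_minimal].
  exact: cone_exact hJ exF exG phi0 phiS colonL sumC.
- rewrite /maxn; case: (ltnP p q.+1) => h; first by rewrite rkS addn_gt0 Fq orbT.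
  by case: p h Gp {Gge} => [|p] // _ Gp; rewrite rkS addn_gt0 Gp.
- by case=> // i; rewrite gtn_max rkS => /andP[hi1 hi2]; rewrite Gge // Fge.
Qed.

End HasMinRes.

(** * Monomial ideals *)

Section MonomialIdeal.
Variables (K : fieldType) (n : nat).
Local Notation S := {mpoly K[n]}.
Implicit Types (P : pred 'X_{1..n}) (p : S) (m : 'X_{1..n}).

Definition upclosed P := forall m a, P m -> P (m + a)%MM.

(** The ideal spanned by the monomials satisfying [P]; it is an ideal as soon as
    [P] is closed under multiplication. *)
Definition mideal P p : Prop := forall m, p@_m != 0 -> P m.

Lemma midealX P m : P m -> mideal P 'X_[m].
Proof. by move=> Pm k; rewrite mcoeffX; case: (m =P k) => [<-|]; rewrite ?eqxx. Qed.

Lemma mideal_homog P : upclosed P -> homog_ideal (mideal P).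
Proof.
move=> Pup; split.
- by move=> m; rewrite mcoeff0 eqxx.
- move=> p q hp hq m; rewrite mcoeffD => h.
  have [p0|/hp //] := eqVneq p@_m 0.
  by apply: hq; apply: contraNneq h => ->; rewrite p0 addr0.
- move=> a p hp m.
  rewrite -mcoeff_msupp => /msuppM_le/allpairsP[[m1 m2] /= [h1 h2 ->]].
  by rewrite addmC; apply/Pup/hp; rewrite -mcoeff_msupp.
- move=> d p hp m; rewrite mcoeff_hcomp.
  by case: (_ =P d) => _; [exact: hp | rewrite eqxx].
Qed.

Lemma eq_mideal P Q : P =1 Q -> forall p, mideal P p <-> mideal Q p.
Proof. by move=> PQ p; split=> h m /h; rewrite PQ. Qed.

Lemma mideal_mulX P a p :
  mideal P (p * 'X_[a]) <-> mideal (fun m => P (m + a)%MM) p.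
Proof.
split=> h m; first by rewrite -(mcoeffMX p a) addmC => /h; rewrite addmC.
rewrite -mcoeff_msupp (perm_mem (msuppMX p a)) => /mapP[k].
by rewrite mcoeff_msupp => /h hk ->; rewrite addmC.
Qed.

Lemma mideal_addX P a : upclosed P -> forall p,
  mideal (fun m => P m || (a <= m)%MM) p <-> exists c, mideal P (p - c * 'X_[a]).
Proof.
move=> Pup p; have hP := mideal_homog Pup; split=> [h|[c hc] m].
  exists (\sum_(m <- msupp p | ~~ P m) p@_m *: 'X_[m - a]).
  rewrite {1}[p]mpolyE (bigID P) /= mulr_suml -addrA -sumrB.
  rewrite [X in _ + X]big_seq_cond [X in _ + X]big1 => [|m /andP[]].
    rewrite addr0; apply: (hideal_sum hP) => m Pm.
    by rewrite -mul_mpolyC; apply: (hidealM hP); apply: midealX.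
  rewrite mcoeff_msupp => /h /orP[-> //|ham] _.
  by rewrite -scalerAl -mpolyXD submK // subrr.
move=> pm; case: (boolP (a <= m)%MM) => [_|ham]; first by rewrite orbT.
rewrite orbF; apply: hc; rewrite mcoeffB.
suff -> : (c * 'X_[a])@_m = 0 by rewrite subr0.
apply/eqP; rewrite -[_ == 0]negbK -mcoeff_msupp (perm_mem (msuppMX c a)).
apply/mapP => -[k _ mk]; move/negP: ham; apply.
by rewrite mk lem_addr.
Qed.

Lemma eq_has_min_res (I J : S -> Prop) l :
  (forall h, I h <-> J h) -> has_min_res I l -> has_min_res J l.
Proof.
move=> IJ [F [[gF [ex0 ex1 ex2] mF] Fp Fge]]; exists F; split=> //; split=> //.
split=> //; first by move=> f; have [u /IJ] := ex0 f; exists u.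
by move=> u; rewrite -IJ; apply: ex1.
Qed.

(** The cone for the monomials [g = 'X_[a]] and [x = 'X_i].  The
    invariance hypothesis says that the colon ideals by ['X_[a]] and by
    ['X_i * 'X_[a]] agree. *)
Lemma has_min_res_addX P a i k l : upclosed P ->
  (forall m, P (m + (U_(i) + a))%MM = P (m + a)%MM) ->
  has_min_res (mideal P) k ->
  has_min_res (mideal (fun m => P (m + a)%MM)) l ->
  has_min_res (mideal (fun m => P m || (U_(i) + a <= m)%MM)) (maxn k l.+1).
Proof.
move=> Pup Pia; apply: (has_min_res_cone (x := 'X_i) (g := 'X_[a])
  (d := mdeg U_(i)) (e := mdeg a)); try exact: homogzX.
- exact: mideal_homog.
- by apply: mideal_homog => m b; rewrite -addmA (addmC b) addmA; apply: Pup.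
- rewrite mcoeffX eq_sym; case: eqP => // /(congr1 (fun m => m i)).
  by rewrite mnm0E mnm1E eqxx.
- move=> h; rewrite -mpolyXD mideal_mulX; apply: eq_mideal => m.
  by rewrite Pia.
- by move=> h /mideal_mulX.
- by move=> h; rewrite -mpolyXD; apply: mideal_addX.
Qed.

Lemma has_min_res0 : has_min_res (mideal pred0) 0.
Proof.
have ideal0 p : mideal pred0 p <-> p = 0.
  split=> [h|-> m]; last by rewrite mcoeff0 eqxx.
  by apply/mpolyP => m; rewrite mcoeff0; apply/eqP/negPn/negP => /h.
exists (@FreeComplex K n (fun i => if i is 0%N then 1%N else 0%N)
   (fun _ _ => 0) 1%:M (fun=> 0)); split=> //; last by case.
split.
- split=> [j|i j k]; last by rewrite mxE homogz0.
  rewrite mxE ord1 eqxx; have := @homogzX K n 0%MM.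
  by rewrite mdeg0 mpolyX0.
- split.
  + by move=> f; exists f%:M; apply/ideal0; rewrite mulmx1 mxE eqxx subrr.
  + move=> u; rewrite mulmx1; split=> [/ideal0 h|[w ->]].
      by exists 0; apply/rowP => j; rewrite ord1 h mulmx0 mxE.
    by apply/ideal0; rewrite mulmx0 mxE.
  + move=> i u; split=> _; last by rewrite mulmx0.
    by exists 0; apply/rowP => -[].
- by move=> i j k; rewrite mxE mcoeff0.
Qed.

End MonomialIdeal.

(** * Extension of scalars along an inclusion of variables *)

Lemma eq_rmorph_mpoly (R T : comNzRingType) (n : nat)
    (f g : {rmorphism {mpoly R[n]} -> T}) :
  (forall c, f c%:MP = g c%:MP) -> (forall i, f 'X_i = g 'X_i) -> f =1 g.
Proof.
move=> fgC fgX p; rewrite [p]mpolyE !rmorph_sum; apply: eq_bigr => m _.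
rewrite -mul_mpolyC !rmorphM fgC mpolyXE_id !rmorph_prod /=; congr (_ * _).
by apply: eq_bigr => i _; rewrite !rmorphXn /= fgX.
Qed.

(** [R] is the ring on the variables indexed by ['I_m], viewed in [S] through
    [s].  As an [R]-module, [S] is spanned by the monomials, and the coordinates
    [slice a] below are [R]-linear; this is all the flatness that is used. *)
Section BaseChange.
Variables (K : fieldType) (m n : nat) (s : 'I_m -> 'I_n).
Hypothesis s_inj : injective s.
Local Notation R := {mpoly K[m]}.
Local Notation S := {mpoly K[n]}.

Definition relabel : R -> S := mmap (@mpolyC n K) (fun i => 'X_(s i)).
HB.instance Definition _ := GRing.RMorphism.on relabel.

(** [S] as a polynomial ring over [R], in which the variables coming from [R]
    are moved to the coefficients.  All [n] variables are kept as indeterminates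
    of the target, so that no enumeration of the remaining ones is needed; this
    map is a section of [merge_vars]. *)
Definition split_vars : S -> {mpoly R[n]} :=
  mmap (@mpolyC n R \o @mpolyC m K)
       (fun j => if [pick i | s i == j] is Some i then ('X_i)%:MP else 'X_j).
HB.instance Definition _ := GRing.RMorphism.on split_vars.

Definition merge_vars : {mpoly R[n]} -> S := mmap relabel (fun j => 'X_j).
HB.instance Definition _ := GRing.RMorphism.on merge_vars.

Definition slice (a : 'X_{1..n}) (p : S) : R := (split_vars p)@_a.

Lemma slice_is_additive a : additive (slice a).
Proof. by move=> p q; rewrite /slice rmorphB mcoeffB. Qed.
HB.instance Definition _ a :=
  GRing.isAdditive.Build S R (slice a) (slice_is_additive a).

Lemma relabelC c : relabel c%:MP = c%:MP.
Proof. exact: mmapC. Qed.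

Lemma relabel_var i : relabel 'X_i = 'X_(s i).
Proof. by rewrite /relabel mmapX mmap1U. Qed.

Lemma split_relabel p : split_vars (relabel p) = p%:MP.
Proof.
apply: (@eq_rmorph_mpoly K _ m
  (split_vars \o relabel) (@mpolyC n R)) => [c|i] /=.
  by rewrite relabelC /split_vars mmapC.
rewrite relabel_var /split_vars mmapX mmap1U.
by case: pickP => [j /eqP/s_inj -> //|/(_ i)]; rewrite eqxx.
Qed.

Lemma split_varsK : cancel split_vars merge_vars.
Proof.
apply: (@eq_rmorph_mpoly K _ n (merge_vars \o split_vars) idfun) => [c|j] /=.
  by rewrite /split_vars mmapC /merge_vars /= mmapC; apply: relabelC.
rewrite /split_vars mmapX mmap1U /merge_vars.
case: pickP => [i /eqP <-|_]; first by rewrite mmapC; apply: relabel_var.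
by rewrite mmapX mmap1U.
Qed.

Lemma slice_relabelM a p q : slice a (relabel p * q) = p * slice a q.
Proof. by rewrite /slice rmorphM /= split_relabel mcoeffCM. Qed.

Lemma slice_sum k p : (msize (split_vars p) <= k)%N ->
  p = \sum_(a : 'X_{1..n < k}) relabel (slice a p) * 'X_[a].
Proof.
move=> le_k; rewrite -[LHS]split_varsK /merge_vars (mmapE k) //.
by apply: eq_bigr => a _; rewrite mmap1_id.
Qed.

Lemma slice_sum_mx a b (M : 'M[S]_(a, b)) : exists k,
  M = \sum_(c : 'X_{1..n < k}) 'X_[c] *: map_mx relabel (map_mx (slice c) M).
Proof.
pose size_at (ij : 'I_a * 'I_b) := msize (split_vars (M ij.1 ij.2)).
exists (\max_ij size_at ij)%N; apply/matrixP => i j; rewrite summxE.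
rewrite [LHS](slice_sum (leq_bigmax (F := size_at) (i, j))).
by apply: eq_bigr => c _; rewrite !mxE mulrC.
Qed.

Lemma map_slice_mulmx c a b d (M : 'M[S]_(a, b)) (N : 'M[R]_(b, d)) :
  map_mx (slice c) (M *m map_mx relabel N) = map_mx (slice c) M *m N.
Proof.
apply/matrixP => i j; rewrite !mxE raddf_sum; apply: eq_bigr => k _ /=.
by rewrite !mxE [X in slice c X]mulrC slice_relabelM mulrC.
Qed.

Definition base_change (F : free_complex K m) : free_complex K n :=
  @FreeComplex K n (rk F) (@shift _ _ F) (map_mx relabel (aug F))
    (fun i => map_mx relabel (diff F i)).

(** The extension of [I] to [S]. *)
Definition ideal_ext (I : R -> Prop) (p : S) : Prop := forall a, I (slice a p).

Lemma ideal_ext_relabelM I p q :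
  homog_ideal I -> I p -> ideal_ext I (relabel p * q).
Proof. by move=> hI Ip a; rewrite slice_relabelM mulrC; apply: (hidealM hI). Qed.

(** Solvability of [u = w *m B] over [S] reduces to solvability over [R], one
    slice at a time; the solution is reassembled from finitely many slices. *)
Lemma lift_slices b d (B : 'M[R]_(b, d)) (u : 'rV[S]_d) :
  (forall c, exists w, map_mx (slice c) u = w *m B) ->
  exists w, u = w *m map_mx relabel B.
Proof.
move=> h; have [k ->] := slice_sum_mx u.
have /fin_all_exists[w hw] : forall c : 'X_{1..n < k}, exists w,
  map_mx (slice c) u = w *m B by move=> c; apply: h.
exists (\sum_c 'X_[c : 'X_{1..n < k}] *: map_mx relabel (w c)).
rewrite mulmx_suml; apply: eq_bigr => c _.
by rewrite hw map_mxM -scalemxAl.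
Qed.

Lemma base_change_exact (I : R -> Prop) F : homog_ideal I ->
  exact_augmented I F -> exact_augmented (ideal_ext I) (base_change F).
Proof.
move=> hI [ex0 ex1 ex2]; split.
- move=> f; set k := msize (split_vars f).
  have /fin_all_exists[u hu] : forall c : 'X_{1..n < k}, exists u : 'rV_(rk F 0),
    I (slice c f - (u *m aug F) 0 0) by move=> c; apply: ex0.
  exists (\sum_c 'X_[c : 'X_{1..n < k}] *: map_mx relabel (u c)).
  rewrite {1}[f](@slice_sum k) // mulmx_suml summxE -sumrB => a.
  rewrite raddf_sum; apply: (hideal_sum hI) => c _ /=.
  rewrite -scalemxAl -map_mxM mxE [X in _ - _ * X]mxE [X in X - _]mulrC -mulrBr.
  by rewrite -rmorphB mulrC; apply: ideal_ext_relabelM.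
- move=> u; split=> [h|[w ->] c].
    apply: lift_slices => c; apply/ex1.
    by rewrite -map_slice_mulmx mxE; apply: h.
  have := map_slice_mulmx c (w *m map_mx relabel (diff F 0)) (aug F).
  move/matrixP => /(_ 0 0); rewrite mxE => ->; apply/ex1.
  by exists (map_mx (slice c) w); rewrite map_slice_mulmx.
- move=> i u; split=> [h|[w ->]].
    apply: lift_slices => c; apply/ex2.
    by rewrite -map_slice_mulmx h; apply/matrixP => j k; rewrite !mxE raddf0.
  rewrite -mulmxA -map_mxM (_ : diff F i.+1 *m diff F i = 0).
    by rewrite map_mx0 mulmx0.
  apply/row_matrixP => j; rewrite row_mul row0; apply/ex2.
  by exists (delta_mx 0 j); rewrite rowE.
Qed.

Lemma relabel_const p : (relabel p)@_0%MM = p@_0%MM.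
Proof.
apply: (@eq_rmorph_mpoly K _ m
  (mcoeff 0%MM \o relabel) (mcoeff 0%MM)) => [c|i] /=.
  by rewrite relabelC !mcoeffC !eqxx.
rewrite relabel_var !mcoeffX; congr (nat_of_bool _)%:R.
by apply/eqP/eqP => /(congr1 mdeg); rewrite mdeg1 mdeg0.
Qed.

Definition push (a : 'X_{1..m}) : 'X_{1..n} := (\sum_i U_(s i) *+ a i)%MM.
Definition pull (a : 'X_{1..n}) : 'X_{1..m} := [multinom a (s i) | i < m].

Lemma relabelX a : relabel 'X_[a] = 'X_[push a].
Proof. by rewrite /relabel mmapX /mmap1 mprodXnE. Qed.

Lemma pushE a j : push a j = (\sum_(i | s i == j) a i)%N.
Proof.
rewrite mnm_sumE [RHS]big_mkcond; apply: eq_bigr => i _.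
by rewrite mulmnE mnm1E; case: eqP => _; rewrite ?mul1n.
Qed.

Lemma pushK : cancel push pull.
Proof.
move=> a; apply/mnmP => i; rewrite mnmE pushE.
by rewrite (big_pred1 i) // => j; rewrite /= (inj_eq s_inj).
Qed.

Lemma push_pull_le a : (push (pull a) <= a)%MM.
Proof.
apply/mnm_lepP => j; rewrite pushE.
case: (pickP (fun i => s i == j)) => [i /eqP <-|h]; last by rewrite big_pred0.
rewrite (big_pred1 i) ?mnmE // => k; exact: (inj_eq s_inj).
Qed.

Lemma mdeg_push a : mdeg (push a) = mdeg a.
Proof.
rewrite /push mdeg_sum mdegE; apply: eq_bigr => i _.
by rewrite mdegMn mdeg1 mul1n.
Qed.

Lemma relabel_homog d p : homogz d p -> homogz d (relabel p).
Proof.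
move/homogzP => h; rewrite {1}[p]mpolyE rmorph_sum big_seq; apply: homogz_sum => a.
rewrite mcoeff_msupp -mul_mpolyC rmorphM /= relabelC relabelX => /h <-.
rewrite -[Posz _]add0r; apply: homogzM; last by rewrite -mdeg_push homogzX.
apply/homogzP => b; rewrite mcoeffC.
case: (b =P 0%MM) => [->|]; rewrite ?mulr0 ?eqxx //.
by rewrite mdeg0.
Qed.

(** A monomial of [S] is the product of its part in the variables of [R] and of
    the rest, and only the first part decides membership in the extended
    ideal. *)
Lemma mideal_ext P p : upclosed P ->
  mideal (fun a => P (pull a)) p <-> ideal_ext (mideal P) p.
Proof.
move=> Pup; have hP := mideal_homog K Pup; split=> [h c|h].
  rewrite [p]mpolyE raddf_sum big_seq; apply: (hideal_sum hP) => a /=.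
  rewrite mcoeff_msupp => /h Pa; rewrite -(submK (push_pull_le a)).
  rewrite addmC mpolyXD -relabelX scalerAr -mul_mpolyC.
  by apply: (ideal_ext_relabelM _ hP _ c); apply: midealX.
have hP' : homog_ideal (mideal (fun a => P (pull a)) : S -> Prop).
  apply: mideal_homog => a b Pa.
  suff -> : pull (a + b) = (pull a + pull b)%MM by apply: Pup.
  by apply/mnmP => i; rewrite !mnmE.
rewrite [p](slice_sum (leqnn _)); apply: (hideal_sum hP') => c _.
rewrite mulrC; apply: (hidealM hP').
have {h}hc := h (c : 'X_{1..n}).
rewrite [slice c p]mpolyE rmorph_sum big_seq; apply: (hideal_sum hP') => a /=.
rewrite mcoeff_msupp => /hc Pa; rewrite -mul_mpolyC rmorphM; apply: (hidealM hP').
by rewrite /= relabelX; apply: midealX; rewrite pushK.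
Qed.

Lemma has_min_res_base_change P l : upclosed P ->
  has_min_res (mideal P : R -> Prop) l ->
  has_min_res (mideal (fun a => P (pull a)) : S -> Prop) l.
Proof.
move=> Pup [F [[[aF dF] exF mF] Fl Fge]].
apply: (@eq_has_min_res _ _ (ideal_ext (mideal P))).
  by move=> h; rewrite mideal_ext.
exists (base_change F); split=> //; split.
- split=> [j|i j k]; rewrite mxE; apply: relabel_homog; [exact: aF | exact: dF].
- exact: base_change_exact (mideal_homog K Pup) exF.
- by move=> i j k; rewrite mxE relabel_const; apply: mF.
Qed.

End BaseChange.

(** * Edge ideals *)

Section EdgeIdeal.
Variables (K : fieldType) (G : sgraph).
Implicit Types (D : {set G}) (m : 'X_{1..#|G|}) (x y : G).

(** The monomials of the edge ideal of [G] with the vertices of [D] deleted, but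
    in the variables of the whole graph [G], where the ideals of the different
    subgraphs can be compared. *)
Definition supp_edge D m : bool :=
  [exists x, exists y, [&& x \notin D, y \notin D, edge x y,
     (0 < m (enum_rank x))%N & (0 < m (enum_rank y))%N]].

Lemma supp_edgeP D m :
  reflect (exists x y, [/\ x \notin D, y \notin D, edge x y,
     (0 < m (enum_rank x))%N & (0 < m (enum_rank y))%N]) (supp_edge D m).
Proof.
apply: (iffP existsP) => [[x /existsP[y /and5P h]]|[x [y h]]]; first by exists x, y.
by exists x; apply/existsP; exists y; apply/and5P.
Qed.

Lemma supp_edge_upclosed D : upclosed (supp_edge D).
Proof.
move=> m a /supp_edgeP[x [y [xD yD xy mx my]]]; apply/supp_edgeP; exists x, y.
by rewrite !mnmDE !addn_gt0 mx my.
Qed.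

Lemma edge_neq x y : edge x y -> x != y.
Proof. by apply: contraTneq => ->; rewrite edge_irrefl. Qed.

Lemma mnm1_rank x y : U_(enum_rank x)%MM (enum_rank y) = (x == y).
Proof. by rewrite mnm1E (inj_eq enum_rank_inj). Qed.

Lemma le_edge_mnm x y m : edge x y ->
  (U_(enum_rank x) + U_(enum_rank y) <= m)%MM =
  (0 < m (enum_rank x))%N && (0 < m (enum_rank y))%N.
Proof.
move=> /edge_neq nxy; apply/mnm_lepP/andP => [h|[mx my] i].
  split; [apply: leq_trans (h (enum_rank x)) | apply: leq_trans (h (enum_rank y))];
    by rewrite mnmDE !mnm1_rank eqxx ?addn1.
rewrite mnmDE !mnm1E -[i]enum_valK !(inj_eq enum_rank_inj).
case: eqP => [<-|_]; first by rewrite eq_sym (negbTE nxy).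
by case: eqP => [<-|_].
Qed.

Lemma edge_ideal_edge (p : vpoly K G) x y :
  edge x y -> edge_ideal (p * (vvar K x * vvar K y)).
Proof.
move=> xy; exists (fun x' y' => p *+ ((x' == x) && (y' == y))).
rewrite (bigD1 x) //= (bigD1 y) //= !eqxx mulr1n.
rewrite !big1 ?addr0 // => [x' nx|y' /andP[_ /negbTE ny]].
  by rewrite big1 // => y' _; rewrite (negbTE nx) mulr0n mul0r.
by rewrite ny mulr0n mul0r.
Qed.

Lemma edge_ideal_sum (I : Type) (r : seq I) (P : pred I) (F : I -> vpoly K G) :
  (forall i, P i -> edge_ideal (F i)) -> edge_ideal (\sum_(i <- r | P i) F i).
Proof.
move=> h; apply: (big_ind (@edge_ideal K G)) h.
  exists (fun _ _ => 0); rewrite big1 // => x _.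
  by rewrite big1 // => y _; rewrite mul0r.
move=> p q [c ->] [d ->]; exists (fun x y => c x y + d x y).
rewrite -big_split; apply: eq_bigr => x _ /=; rewrite -big_split.
by apply: eq_bigr => y _; rewrite mulrDl.
Qed.

Lemma edge_idealE (f : vpoly K G) : edge_ideal f <-> mideal (supp_edge set0) f.
Proof.
split=> [[c ->]|h].
  have hI := mideal_homog K (@supp_edge_upclosed set0).
  apply: (hideal_sum hI) => x _; apply: (hideal_sum hI) => y xy.
  apply: (hidealM hI); rewrite /vvar -mpolyXD; apply: midealX.
  apply/supp_edgeP; exists x, y; rewrite !inE !mnmDE !mnm1_rank !eqxx.
  by rewrite addn1.
rewrite [f]mpolyE big_seq; apply: edge_ideal_sum => m.
rewrite mcoeff_msupp => /h/supp_edgeP[x [y [_ _ xy mx my]]].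
have /submK <- : (U_(enum_rank x) + U_(enum_rank y) <= m)%MM.
  by rewrite le_edge_mnm // mx.
by rewrite !mpolyXD scalerAl; apply: edge_ideal_edge.
Qed.

Lemma edge_ideal_homog : homog_ideal (@edge_ideal K G).
Proof.
have [h0 hD hM hc] := mideal_homog K (@supp_edge_upclosed set0).
split=> [|p q|a p|d p]; rewrite !edge_idealE;
  [exact: h0 | exact: hD | exact: hM | exact: hc].
Qed.


End EdgeIdeal.

Lemma has_min_res_delete (K : fieldType) (G : sgraph) (D : {set G}) l :
  has_min_res (@edge_ideal K (delete_vertices D)) l ->
  has_min_res (mideal (supp_edge D) : vpoly K G -> Prop) l.
Proof.
move/(eq_has_min_res (@edge_idealE K (delete_vertices D))) => h.
pose s (i : 'I_#|delete_vertices D|) := enum_rank (val (enum_val i)) : 'I_#|G|.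
have s_inj : injective s by move=> i j /enum_rank_inj/val_inj; exact: enum_val_inj.
have := has_min_res_base_change s_inj (@supp_edge_upclosed _ set0) h.
apply: eq_has_min_res; apply: eq_mideal => m.
have pullE (x : delete_vertices D) :
    pull s m (enum_rank x) = m (enum_rank (val x)).
  by rewrite mnmE /s enum_rankK.
apply/supp_edgeP/supp_edgeP => [[x [y [_ _ xy]]]|[x [y [xD yD xy mx my]]]].
  rewrite !pullE => mx my; exists (val x), (val y).
  by split=> //; [exact: (valP x) | exact: (valP y)].
exists (exist _ x xD), (exist _ y yD); split; rewrite ?inE //.
  by rewrite (pullE (exist _ x xD)).
by rewrite (pullE (exist _ y yD)).
Qed.

(** * Deleting a leaf *)

(** Adding a variable that is regular modulo the ideal lengthens the minimal
    resolution by one. *)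
Lemma has_min_res_add_var (K : fieldType) n (P : pred 'X_{1..n}) i l :
  upclosed P -> (forall m, P (m + U_(i))%MM = P m) ->
  has_min_res (mideal P : {mpoly K[n]} -> Prop) l ->
  has_min_res (mideal (fun m => P m || (0 < m i)%N) : {mpoly K[n]} -> Prop) l.+1.
Proof.
move=> Pup Pi hP.
have := @has_min_res_addX K n P 0%MM i l l Pup.
rewrite (maxn_idPr (leqnSn l)) => H.
apply: (eq_has_min_res _ (H _ hP _)) => [|m|].
- by apply: eq_mideal => m; rewrite addm0 lep1mP lt0n.
- by rewrite !addm0 Pi.
- by apply: eq_has_min_res hP; apply: eq_mideal => m; rewrite addm0.
Qed.

Section Leaf.
Variables (K : fieldType) (G : sgraph) (v v1 : G).
Hypothesis leaf_v1 : neighbours v1 = [set v].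
Local Notation rank := enum_rank.

Let edge_v1 y : edge v1 y = (y == v).
Proof. by have /setP/(_ y) := leaf_v1; rewrite !inE. Qed.

(** The vertices of [s] are deleted from the graph whose edge ideal is
    considered, so each of them is a new variable. *)
Lemma has_min_res_add_neighbours l (s : seq G) :
  uniq s -> {subset s <= neighbours v} ->
  has_min_res (mideal (supp_edge (v |: neighbours v)) : vpoly K G -> Prop) l ->
  has_min_res (mideal (fun m => supp_edge (v |: neighbours v) m ||
     has (fun y => 0 < m (rank y))%N s) : vpoly K G -> Prop) (l + size s)%N.
Proof.
move=> us sN hl; elim: s us sN => [_ _|y s IH /= /andP[ys us] sN].
  by rewrite addn0; apply: eq_has_min_res hl; apply: eq_mideal => m; rewrite orbF.
have yN : y \in neighbours v by apply: sN; rewrite mem_head.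
have {IH} := IH us (fun z zs => sN z (mem_behead (s := y :: s) zs)).
move/(@has_min_res_add_var K _ _ (rank y)) => H.
rewrite addnS; apply: eq_has_min_res (H _ _); last first.
- move=> m; congr (_ || _).
    apply/supp_edgeP/supp_edgeP => -[x [z [xD zD xz]]]; rewrite ?mnmDE ?mnm1_rank.
      have nyx : (y == x) = false.
        by apply: contraNF xD => /eqP <-; rewrite inE yN orbT.
      have nyz : (y == z) = false.
        by apply: contraNF zD => /eqP <-; rewrite inE yN orbT.
      by rewrite nyx nyz !addn0 => mx mz; exists x, z.
    by move=> mx mz; exists x, z; rewrite !mnmDE !ltn_addr.
  apply: eq_in_has => z zs; rewrite mnmDE mnm1_rank.
  by case: (y =P z) ys => [->|_ _]; rewrite ?zs ?addn0.
- move=> m a /orP[|/hasP[z zs mz]]; first by move/supp_edge_upclosed => ->.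
  by apply/orP; right; apply/hasP; exists z; rewrite // mnmDE ltn_addr.
- by apply: eq_mideal => m; rewrite /= -orbA; congr orb; rewrite orbC.
Qed.

(** The colon ideal of [v] in the edge ideal of the graph without the leaf: an
    edge at [v] becomes the variable of its other end, and an edge at a neighbour
    of [v] is a multiple of that variable. *)
Lemma supp_edge_colon m :
  supp_edge [set v1] (m + U_(rank v))%MM =
  supp_edge (v |: neighbours v) m ||
  has (fun y => 0 < m (rank y))%N (enum (neighbours v :\ v1)).
Proof.
have v1v : edge v v1 by rewrite edge_sym edge_v1.
have hasI y : edge v y -> y != v1 -> (0 < m (rank y))%N ->
    has (fun y => 0 < m (rank y))%N (enum (neighbours v :\ v1)).
  by move=> vy yv1 my; apply/hasP; exists y; rewrite // mem_enum !inE yv1.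
apply/supp_edgeP/orP => [[x [y []]]|].
  rewrite !inE !mnmDE !mnm1_rank => xv1 yv1 xy mx my.
  case: (eqVneq v x) => [vx|nvx].
    right; apply: (hasI y) => //; first by rewrite vx.
    by move: my; rewrite vx (negbTE (edge_neq xy)) addn0.
  case: (eqVneq v y) => [vy|nvy].
    right; apply: (hasI x) => //; first by rewrite vy edge_sym.
    by move: mx; rewrite (negbTE nvx) addn0.
  move: mx my; rewrite (negbTE nvx) (negbTE nvy) !addn0 => mx my.
  case: (boolP (edge v x)) => vx; first by right; apply: (hasI x).
  case: (boolP (edge v y)) => vy; first by right; apply: (hasI y).
  left; apply/supp_edgeP; exists x, y; rewrite !inE !negb_or vx vy.
  by rewrite !(eq_sym _ v) nvx nvy.
case=> [/supp_edgeP[x [y []]]|/hasP[y]].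
  rewrite !inE !negb_or => /andP[nxv vx] /andP[nyv vy] xy mx my.
  exists x, y; rewrite !inE !mnmDE !ltn_addr //; split=> //.
    by apply: contraNneq vx => ->.
  by apply: contraNneq vy => ->.
rewrite mem_enum !inE => /andP[yv1 vy] my; exists v, y.
rewrite !inE !mnmDE mnm1_rank eqxx addn1 ltn_addr //; split=> //.
exact: edge_neq.
Qed.

Lemma supp_edge_leaf m :
  supp_edge set0 m =
  supp_edge [set v1] m || (U_(rank v1) + U_(rank v) <= m)%MM.
Proof.
have v1v : edge v1 v by rewrite edge_v1.
rewrite le_edge_mnm //; apply/supp_edgeP/orP => [[x [y [_ _ xy mx my]]]|].
  case: (eqVneq x v1) => [xv1|nx].
    by right; move: xy my; rewrite xv1 edge_v1 => /eqP <- ->; rewrite -xv1 mx.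
  case: (eqVneq y v1) => [yv1|ny].
    right; move: xy mx; rewrite yv1 edge_sym edge_v1 => /eqP <- ->.
    by rewrite -yv1 my.
  by left; apply/supp_edgeP; exists x, y; rewrite !inE.
case=> [/supp_edgeP[x [y [_ _ xy mx my]]]|/andP[m1 mv]].
  by exists x, y; rewrite !inE.
by exists v1, v; rewrite !inE.
Qed.

(** The cone for [x = v1] and [g = v].  The colon ideal is resolved in length
    [l + degree v - 1], one variable for each neighbour of [v] except [v1]. *)
Lemma has_min_res_leaf k l :
  has_min_res (@edge_ideal K (delete_vertices [set v1])) k ->
  has_min_res (@edge_ideal K (delete_vertices (v |: neighbours v))) l ->
  has_min_res (@edge_ideal K G) (maxn k (l + degree v)).
Proof.
move=> /has_min_res_delete hk /has_min_res_delete hl.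
have v1v : v1 \in neighbours v by rewrite inE edge_sym edge_v1.
have := has_min_res_add_neighbours
  (s := enum (neighbours v :\ v1)) (enum_uniq _) _ hl.
rewrite -cardE => H.
have {}H : has_min_res (mideal (fun m => supp_edge [set v1] (m + U_(rank v))%MM)
      : vpoly K G -> Prop) (l + #|neighbours v :\ v1|).
  apply: eq_has_min_res (H _) => [|y]; last by rewrite mem_enum => /setD1P[].
  by apply: eq_mideal => m; rewrite supp_edge_colon.
rewrite /degree (cardsD1 v1) v1v addnCA add1n.
apply: eq_has_min_res
  (has_min_res_addX (i := rank v1) (@supp_edge_upclosed _ _) _ hk H).
  by move=> h; rewrite edge_idealE; apply: eq_mideal => m; rewrite supp_edge_leaf.
move=> m; apply/supp_edgeP/supp_edgeP => -[x [y []]];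
  rewrite !inE !mnmDE !mnm1_rank => x1 y1.
  rewrite !(eq_sym v1) (negbTE x1) (negbTE y1) !add0n => *.
  by exists x, y; rewrite !inE !mnmDE !mnm1_rank.
move=> *; exists x, y; rewrite !inE !mnmDE !mnm1_rank.
by rewrite !(eq_sym v1) (negbTE x1) (negbTE y1) !add0n.
Qed.

End Leaf.

(** * Forests *)


Lemma forest_delete (G : sgraph) (D : {set G}) :
  is_forest G -> is_forest (delete_vertices D).
Proof.
move=> fG c /andP[cy un]; rewrite -(size_map val); apply: fG.
apply/andP; split; last by rewrite map_inj_uniq //; apply: val_inj.
by rewrite cycle_map.
Qed.

(** An end [x] of a longest path [x, y, ...] is a leaf: a neighbour of [x] off the
    path would extend it, and one on the path other than [y] would close a
    cycle.  The induction is on the number of vertices off the path. *)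
Lemma forest_leaf (G : sgraph) (x y : G) : is_forest G -> edge x y ->
  exists v1 v : G, neighbours v1 = [set v].
Proof.
move=> fG xy.
suff H k : forall (x y : G) p, (#|G| - size p <= k)%N -> uniq (x :: y :: p) ->
    path (@edge G) x (y :: p) -> exists v1 v : G, neighbours v1 = [set v].
  by apply: (H #|G| x y [::]); rewrite /= ?leq_subr ?xy ?inE ?edge_neq.
elim: k => [|k IH] {xy}x {}y p hk un pa.
  have := max_card (mem (x :: y :: p)); rewrite (card_uniqP un).
  move: hk; rewrite leqn0 subn_eq0 => hk /leq_trans/(_ hk).
  by rewrite /= ltnNge leqnSn.
have /= /andP[xy pa'] := pa.
case: (pickP [pred z | edge x z & z != y]) => [z /= /andP[xz nzy]|none]; last first.
  exists x, y; apply/setP => z; rewrite !inE; have /= := none z.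
  by case: eqP => [-> //|_]; rewrite andbT.
case: (boolP (z \in x :: y :: p)) => [|zp]; last first.
  apply: (IH z x (y :: p)); rewrite /= ?(edge_sym z) ?xz //=.
    by rewrite subnS; move: hk; case: (_ - _)%N.
  by move: un; rewrite /= zp.
rewrite !inE (negbTE nzy) eq_sym (negbTE (edge_neq xz)) /= => zp.
case/splitPr: zp un pa {pa' hk} => p1 p2 un pa.
have /fG : ucycle (@edge G) (x :: y :: rcons p1 z).
  apply/andP; split.
    rewrite /cycle rcons_path /= last_rcons (edge_sym z) xz andbT.
    by move: pa; rewrite -cat_rcons /= cat_path => /and3P[-> ->].
  by move: un; rewrite -cat_rcons -!cat_cons cat_uniq => /and3P[].
by rewrite /= size_rcons.
Qed.

Lemma forest_has_min_res (K : fieldType) (G : sgraph) : is_forest G ->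
  exists l, has_min_res (@edge_ideal K G) l.
Proof.
have edgeless (H : sgraph) : (forall x y : H, ~~ edge x y) ->
    has_min_res (@edge_ideal K H) 0.
  move=> none; apply: eq_has_min_res (has_min_res0 K #|H|) => h.
  rewrite edge_idealE; apply: eq_mideal => m.
  by apply/esym/supp_edgeP => -[x [y [_ _ xy _ _]]]; case/negP: (none x y).
move: {2}(#|G|) (leqnn #|G|) => k; elim: k G => [|k IH] G hk fG.
  exists 0%N; apply: edgeless => x; have := fintype0 x.
  by move: hk; rewrite leqn0 => /eqP hk /(_ hk).
case: (pickP (fun xy : G * G => edge xy.1 xy.2)) => [[x y] /= xy|none].
  have [v1 [v leaf]] := forest_leaf fG xy.
  have smaller (D : {set G}) z : z \in D ->
      exists l, has_min_res (@edge_ideal K (delete_vertices D)) l.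
    move=> zD; apply: IH; last exact: forest_delete.
    rewrite card_sig -ltnS (leq_trans _ hk) //; apply: proper_card.
    by rewrite properE subset_predT; apply/subsetPn; exists z; rewrite // inE negbK.
  have [l1 h1] := smaller [set v1] v1 (set11 _).
  have [l2 h2] := smaller (v |: neighbours v) v (setU11 _ _).
  by exists (maxn l1 (l2 + degree v)); apply: (has_min_res_leaf leaf).
exists 0%N; apply: edgeless => x y; exact/negbT/(none (x, y)).
Qed.

Lemma proj_dim_forest (K : fieldType) (G : sgraph) : is_forest G ->
  has_min_res (@edge_ideal K G) (proj_dim K G).
Proof.
move=> /(forest_has_min_res K)[l hl].
by rewrite (proj_dimE (edge_ideal_homog K G) hl).
Qed.

(* The neighbours v_1, ..., v_n of v are [w 0], ..., [w (n - 1)]. *)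
Theorem theorem4p8 (K : fieldType) (T : sgraph) (T_forest : is_forest T)
    (v : T) (n : nat) (n_ge2 : (2 <= n)%N) (w : 'I_n -> T)
    (w_inj : injective w)
    (w_neighbours : neighbours v = [set w i | i : 'I_n])
    (w_leaf : forall i : 'I_n, (i < n.-1)%N -> degree (w i) = 1%N) :
  proj_dim K T =
    maxn (proj_dim K (delete_vertices [set w (Ordinal (ltnW n_ge2))]))
         (proj_dim K (delete_vertices (v |: [set w i | i : 'I_n])) + n)%N.
Proof.
set v1 := w _; rewrite -w_neighbours.
have v1v : v1 \in neighbours v by rewrite w_neighbours imset_f.
have leaf : neighbours v1 = [set v].
  have /eqP/cards1P[u hu] : degree v1 = 1%N by apply: w_leaf => /=; lia.
  rewrite hu; congr [set _]; apply/eqP; rewrite eq_sym.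
  have /setP/(_ v) := hu; rewrite !inE edge_sym.
  by move: v1v; rewrite inE => -> /esym.
have -> : n = degree v by rewrite /degree w_neighbours card_imset // card_ord.
apply: (proj_dimE (edge_ideal_homog K T)).
by apply: (has_min_res_leaf leaf); apply/proj_dim_forest/forest_delete.
Qed.
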